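(* Let $A_1,\dots,A_n$ be $d\times d$ (symmetric) positive definite matrices. Then the barycenter problem for matrix-variate Gaussians $$\min_{X\succ0}\ \sum_{i=1}^n\Big(\operatorname{tr}(A_i\otimes A_i)+\operatorname{tr}(X\otimes X)-2\operatorname{tr}\Big[\big((A_i\otimes A_i)^{1/2}(X\otimes X)(A_i\otimes A_i)^{1/2}\big)^{1/2}\Big]\Big)$$ is convex, i.e. the objective is a convex function (in the Euclidean sense) of $X$ on the convex cone of $d\times d$ positive definite matrices.
   Context: $\otimes$ is the Kronecker product, $\operatorname{tr}$ the trace, $X\succ0$ means $X$ is symmetric positive definite, and $M^{1/2}$ is the unique positive definite square root of a positive definite matrix $M$. ''Euclidean convex'' means convex in the usual sense with respect to the linear structure of the space of symmetric matrices. *)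

(* Defs.v *)
From HB Require Import structures.
From mathcomp Require Import all_boot all_order all_algebra.
From mathcomp Require Import complex mxtens.
From mathcomp Require Import boolp classical_sets reals interval_inference convex.

Set Implicit Arguments.
Unset Strict Implicit.
Unset Printing Implicit Defensive.

Import Order.TTheory GRing.Theory Num.Theory.
Local Open Scope ring_scope.
Local Open Scope classical_set_scope.

Definition posdefmx (R : realType) (m : nat) (A : 'M[R]_m) : Prop :=
  A^T = A /\ forall x : 'cV[R]_m, x != 0 -> 0 < (x^T *m A *m x) 0 0.

Definition posdef_cone (R : realType) (m : nat) : set 'M[R]_m :=
  [set X | posdefmx X].
Arguments posdef_cone R m : clear implicits.

(* The junk value 0 is only taken when M has no positive definite square root;
   [sqrtmxP] and [sqrtmx_unique] below rule this out for M positive definite. *)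
Definition sqrtmx (R : realType) (m : nat) (M : 'M[R]_m) : 'M[R]_m :=
  xget 0 [set S | posdefmx S /\ S *m S = M].

Definition barycenter_objective (R : realType) (n d : nat)
    (A : 'I_n -> 'M[R]_d) (X : 'M[R]_d) : R :=
  \sum_(i < n)
    (\tr (A i *t A i) + \tr (X *t X)
     - 2 * \tr (sqrtmx (sqrtmx (A i *t A i) *m (X *t X)
                        *m sqrtmx (A i *t A i)))).

Section SquareRoot.
Local Open Scope sesquilinear_scope.
Local Open Scope complex_scope.

Let hposdef (C : numClosedFieldType) m (A : 'M[C]_m) :=
  A^t* = A /\ forall x : 'cV[C]_m, x != 0 -> 0 < (x^t* *m A *m x) 0 0.

Let hform_ge0 (C : numClosedFieldType) m (A : 'M[C]_m) (x : 'cV[C]_m) :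
  hposdef A -> 0 <= (x^t* *m A *m x) 0 0.
Proof.
move=> [_ pA]; have [->|/pA/ltW//] := eqVneq x 0.
by rewrite mulmx0 mxE.
Qed.

Let tr_col (C : numClosedFieldType) m (A D : 'M[C]_m) :
  \tr (D^t* *m A *m D) = \sum_i ((col i D)^t* *m A *m col i D) 0 0.
Proof.
apply: eq_bigr => i _; rewrite tr_col map_row -row_mul.
by rewrite !mxE; apply: eq_bigr => j _; rewrite !mxE.
Qed.

Let hsqrt_unique (C : numClosedFieldType) m (S T : 'M[C]_m) :
  hposdef S -> hposdef T -> S *m S = T *m T -> S = T.
Proof.
move=> pS pT ST; pose D := S - T.
have hD : D^t* = D by rewrite /D linearB /= map_mxB pS.1 pT.1.
have tr0 : \tr (D^t* *m S *m D) + \tr (D^t* *m T *m D) = 0.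
  have SDT : S *m D + D *m T = 0 by rewrite mulmxBr mulmxBl ST subrKA subrr.
  rewrite hD -mulmxA (mxtrace_mulC (D *m T)) -mxtraceD -mulmxDr.
  by rewrite SDT mulmx0 mxtrace0.
suff D0 : D = 0 by apply/eqP; rewrite -subr_eq0 -/D D0.
have ge0 (A : 'M[C]_m) : hposdef A -> 0 <= \tr (D^t* *m A *m D).
  by move=> pA; rewrite tr_col; apply: sumr_ge0 => i _; exact: hform_ge0.
have /andP[/eqP trS0 _] :
    (\tr (D^t* *m S *m D) == 0) && (\tr (D^t* *m T *m D) == 0).
  by rewrite -paddr_eq0 ?ge0// tr0.
move: trS0; rewrite tr_col => /psumr_eq0P trS0.
apply/matrixP => i j; rewrite mxE.
have [/(congr1 (fun x : 'cV_m => x i 0))|/pS.2] := eqVneq (col j D) 0.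
  by rewrite !mxE.
by rewrite trS0 ?ltxx// => k _; exact: hform_ge0.
Qed.

Let hsqrt_exists (C : numClosedFieldType) m (M : 'M[C]_m) :
  hposdef M -> exists2 S, hposdef S & S *m S = M.
Proof.
move=> pM; set P := spectralmx M; set d := spectral_diag M.
have uP : P \is unitarymx by exact: spectral_unitarymx.
have hM : M \is hermsymmx.
  by rewrite is_hermitianmxE expr0 scale1r pM.1.
have PP : P *m P^t* = 1%:M by exact/unitarymxP.
have PP' : P^t* *m P = 1%:M by exact: mulmx1C.
have eM : M = P^t* *m diag_mx d *m P.
  have /orthomx_spectralP := hermitian_normalmx hM.
  by rewrite -/P -/d invmx_unitary.
have d_gt0 i : 0 < d 0 i.
  have [v Pv] : exists v : 'cV_m, P *m v = delta_mx i 0.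
    by exists (P^t* *m delta_mx i 0); rewrite mulmxA PP mul1mx.
  have v0 : v != 0.
    apply/eqP => v0; move: Pv; rewrite v0 mulmx0.
    move=> /(congr1 (fun x : 'cV_m => x i 0))/eqP.
    by rewrite !mxE !eqxx eq_sym oner_eq0.
  have := pM.2 v v0; rewrite {1}eM !mulmxA -(mulmxA _ P) Pv.
  have -> : v^t* *m P^t* = delta_mx 0 i.
    rewrite -map_mxM -trmx_mul Pv trmx_delta.
    by apply/matrixP => a b; rewrite !mxE rmorph_nat andbC.
  by rewrite -rowE -colE !mxE eqxx mulr1n.
pose r : 'rV[C]_m := \row_i sqrtC (d 0 i).
have r_gt0 i : 0 < r 0 i by rewrite mxE sqrtC_gt0.
have rr : diag_mx r *m diag_mx r = diag_mx d.
  rewrite mulmx_diag; congr diag_mx; apply/rowP => i.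
  by rewrite !mxE -expr2 sqrtCK.
exists (P^t* *m diag_mx r *m P); last first.
  by rewrite !mulmxA -(mulmxA _ P) PP mulmx1 -(mulmxA _ (diag_mx r) (diag_mx r)) rr.
split.
  rewrite trmx_mul map_mxM trmx_mul map_mxM mulmxA trmxCK tr_diag_mx.
  congr (_ *m _ *m _); apply/matrixP => i j.
  by rewrite ![_ i j]mxE rmorphMn/= conj_Creal// gtr0_real.
move=> x x0; pose y := P *m x.
have y0 : y != 0.
  by apply/eqP => y0; case/eqP: x0; rewrite -[x]mul1mx -PP' -mulmxA -/y y0
     mulmx0.
have -> : x^t* *m (P^t* *m diag_mx r *m P) *m x = y^t* *m diag_mx r *m y.
  by rewrite /y trmx_mul map_mxM !mulmxA.
have [i yi] : exists i, y i 0 != 0 by exact/cV0Pn.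
have E j : (y^t* *m diag_mx r) 0 j * y j 0 = `|y j 0| ^+ 2 * r 0 j.
  by rewrite mul_mx_diag mxE mulrAC [_ 0 j]mxE [_ 0 j]mxE -normCKC.
rewrite mxE (bigD1 i)//= ltr_pwDl//.
  by rewrite E mulr_gt0 ?exprn_gt0 ?normr_gt0.
by apply: sumr_ge0 => j _; rewrite E mulr_ge0 ?exprn_ge0 ?(ltW (r_gt0 j)).
Qed.

Variable R : realType.

Let toC m n (A : 'M[R]_(m, n)) : 'M[R[i]]_(m, n) := map_mx (real_complex R) A.

Let toC_conj m n (A : 'M[R]_(m, n)) : (toC A)^t* = toC A^T.
Proof.
by apply/matrixP => i j; rewrite !mxE conj_Creal// complex_real.
Qed.

Let toC_inj m n : injective (@toC m n).
Proof. exact: map_mx_inj. Qed.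

Let toC_form m (A : 'M[R]_m) (x : 'cV[R]_m) :
  ((toC x)^t* *m toC A *m toC x) 0 0 = ((x^T *m A *m x) 0 0)%:C.
Proof. by rewrite toC_conj -!map_mxM mxE. Qed.

Let posdef_ge0 m (A : 'M[R]_m) (x : 'cV[R]_m) :
  posdefmx A -> 0 <= (x^T *m A *m x) 0 0.
Proof.
move=> [_ pA]; have [->|/pA/ltW//] := eqVneq x 0.
by rewrite mulmx0 mxE.
Qed.

Let toC_posdef m (A : 'M[R]_m) : posdefmx A -> hposdef (toC A).
Proof.
move=> pA; split; first by rewrite toC_conj pA.1.
move=> z z0; pose x := map_mx (@complex.Re R) z.
pose y := map_mx (@complex.Im R) z.
have zE : z = toC x + 'i%C *: toC y.
  by apply/matrixP => i j; rewrite !mxE -complexE.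
have zcE : z^t* = toC x^T - 'i%C *: toC y^T.
  rewrite zE linearD/= linearZ/= map_mxD map_mxZ !toC_conj.
  by rewrite /= conjCi scaleNr.
have sym : (x^T *m A *m y) 0 0 = (y^T *m A *m x) 0 0.
  have -> : x^T *m A *m y = (y^T *m A *m x)^T.
    by rewrite !trmx_mul trmxK pA.1 mulmxA.
  by rewrite mxE.
have -> : (z^t* *m toC A *m z) 0 0 =
    ((x^T *m A *m x) 0 0 + (y^T *m A *m y) 0 0)%:C.
  have DE (U V : 'M[R[i]]_1) : (U + V) 0 0 = U 0 0 + V 0 0 by rewrite mxE.
  have NE (U : 'M[R[i]]_1) : (- U) 0 0 = - U 0 0 by rewrite mxE.
  have ZE c (U : 'M[R[i]]_1) : (c *: U) 0 0 = c * U 0 0 by rewrite mxE.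
  have FE (u v : 'cV[R]_m) :
      (toC u^T *m toC A *m toC v) 0 0 = ((u^T *m A *m v) 0 0)%:C.
    by rewrite -!map_mxM mxE.
  rewrite zcE {1}zE !mulmxBl !mulmxDr -!scalemxAl -!scalemxAr.
  rewrite !(DE, NE, ZE) !FE sym rmorphD/= opprD addrA addrK.
  by rewrite mulrA -expr2 sqr_i mulN1r opprK.
rewrite ltcR.
have [x0|x0] := eqVneq x 0.
  have [y0|y0] := eqVneq y 0.
    by move: z0; rewrite zE x0 y0 /toC !map_mx0 scaler0 addr0 eqxx.
  by rewrite ltr_wpDl ?posdef_ge0// pA.2.
by rewrite ltr_pwDl ?posdef_ge0// pA.2.
Qed.

Let posdef_toC m (A : 'M[R]_m) : hposdef (toC A) -> posdefmx A.
Proof.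
move=> [hA pA]; split; first by apply: toC_inj; rewrite -toC_conj.
move=> x x0; rewrite -ltcR -toC_form pA//.
by apply: contra_neq x0 => x0; apply: toC_inj; rewrite x0 /toC map_mx0.
Qed.

Lemma sqrtmx_unique m (S T : 'M[R]_m) :
  posdefmx S -> posdefmx T -> S *m S = T *m T -> S = T.
Proof.
move=> /toC_posdef pS /toC_posdef pT ST; apply: toC_inj.
by apply: hsqrt_unique => //; rewrite -!map_mxM ST.
Qed.

Lemma sqrtmxP m (M : 'M[R]_m) :
  posdefmx M -> posdefmx (sqrtmx M) /\ sqrtmx M *m sqrtmx M = M.
Proof.
move=> /toC_posdef/hsqrt_exists[S pS SM].
pose T := map_mx (@complex.Re R) S.
have ST : S = toC T.
  have pS' : hposdef (map_mx Num.conj S).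
    split; first by rewrite map_trmx pS.1.
    move=> x x0.
    have -> : (x^t* *m map_mx Num.conj S *m x) 0 0 =
        Num.conj (((map_mx Num.conj x)^t* *m S *m map_mx Num.conj x) 0 0).
      transitivity ((map_mx Num.conj
          ((map_mx Num.conj x)^t* *m S *m map_mx Num.conj x)) 0 0).
        by rewrite !map_mxM map_trmx !map_mxCK.
      by rewrite mxE.
    have px : 0 < ((map_mx Num.conj x)^t* *m S *m map_mx Num.conj x) 0 0.
      by apply: pS.2; rewrite map_mx_eq0.
    by rewrite conj_Creal ?gtr0_real.
  have SS : map_mx Num.conj S = S.
    apply: hsqrt_unique => //; rewrite -map_mxM SM.
    by apply/matrixP => i j; rewrite !mxE; apply: conj_Creal; rewrite complex_real.
  apply/matrixP => i j; rewrite !mxE RRe_real// CrealE.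
  by rewrite -[X in _ == X](congr1 (fun B : 'M_m => B i j) SS) mxE.
apply: (@xgetPex _ 0 [set S | posdefmx S /\ S *m S = M]); exists T; split.
  by apply: posdef_toC; rewrite -ST.
by apply: toC_inj; rewrite /toC map_mxM -/(toC T) -ST.
Qed.

End SquareRoot.

(* Main.v *)
Require Import Defs.
From mathcomp Require Import all_boot all_order all_algebra.
From mathcomp Require Import mxtens ring lra.
From mathcomp Require Import classical_sets reals interval_inference convex.

(** The square root and the product commute with the Kronecker product, and the
    trace is multiplicative for it.  Hence, with S the square root of A_i, the
    i-th summand of the objective equals
      (tr A_i)^2 + (tr X)^2 - 2 (tr (S X S)^(1/2))^2
    ([barycenter_objectiveE]).  The square of the linear form tr X is convex,
    and X |-> S X S is linear, so everything rests on the concavity of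
    Y |-> (tr Y^(1/2))^2 on the positive definite cone
    ([trace_sqrtmx_concave]).

    That function is a lower envelope of linear functions: for every positive
    definite T,
      (tr Y^(1/2))^2 <= tr T * tr (T^-1 Y),
    with equality when T = Y^(1/2).  The inequality is Cauchy-Schwarz for the
    inner product (P, Q) |-> tr (P^T T^-1 Q), applied to Y^(1/2) and T
    ([trace_cauchy_schwarz]).  Concavity along a segment follows by taking for
    T the square root of the intermediate point: the linear function touches
    there and dominates at both ends. *)

Set Implicit Arguments.
Unset Strict Implicit.
Unset Printing Implicit Defensive.

Import Order.TTheory GRing.Theory Num.Theory.
Local Open Scope ring_scope.

Section PositiveDefinite.
Variable R : realType.

Lemma posdef_form_ge0 m (M : 'M[R]_m) (x : 'cV[R]_m) :
  posdefmx M -> 0 <= (x^T *m M *m x) 0 0.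
Proof.
move=> [_ pM]; have [->|/pM/ltW//] := eqVneq x 0.
by rewrite mulmx0 mxE.
Qed.

Lemma posdef1 m : posdefmx (1%:M : 'M[R]_m).
Proof.
split=> [|x x0]; first exact: trmx1.
have [i xi] : exists i, x i 0 != 0 by exact/cV0Pn.
rewrite mulmx1 mxE (bigD1 i)//= ltr_pwDl//.
  by rewrite mxE -expr2 exprn_even_gt0.
by apply: sumr_ge0 => j _; rewrite mxE -expr2 sqr_ge0.
Qed.

(** The left inverse [C] is a convenient witness that [B] is injective, so that
    the change of variable x |-> B x keeps nonzero vectors nonzero. *)
Lemma posdef_congr m k (M : 'M[R]_m) (B : 'M[R]_(m, k)) (C : 'M[R]_(k, m)) :
  posdefmx M -> C *m B = 1%:M -> posdefmx (B^T *m M *m B).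
Proof.
move=> [sM pM] CB; split=> [|x x0]; first by rewrite !trmx_mul trmxK sM mulmxA.
have -> : x^T *m (B^T *m M *m B) *m x = (B *m x)^T *m M *m (B *m x).
  by rewrite trmx_mul !mulmxA.
apply: pM; apply: contra_neq x0 => Bx0.
by rewrite -[x]mul1mx -CB -mulmxA Bx0 mulmx0.
Qed.

Lemma posdef_unitmx m (M : 'M[R]_m) : posdefmx M -> M \in unitmx.
Proof.
move=> [sM pM]; rewrite -row_free_unit -kermx_eq0.
apply/rowV0P => v /sub_kermxP vM.
apply/eqP; rewrite -trmx_eq0; apply/negP => /negP/pM.
by rewrite trmxK vM mul0mx mxE ltxx.
Qed.

(** M^-1 is the congruence of M by M^-1 itself, M being symmetric. *)
Lemma posdef_inv m (M : 'M[R]_m) : posdefmx M -> posdefmx (invmx M).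
Proof.
move=> pM; have uM := posdef_unitmx pM.
have := posdef_congr pM (mulmxV uM).
by rewrite trmx_inv pM.1 mulVmx// mul1mx.
Qed.

Lemma posdef_conv m (M N : 'M[R]_m) (t : R) :
  0 <= t <= 1 -> posdefmx M -> posdefmx N ->
  posdefmx (t *: M + (1 - t) *: N).
Proof.
move=> /andP[t0 t1] [sM pM] [sN pN].
split=> [|x x0]; first by rewrite linearD !linearZ/= sM sN.
rewrite mulmxDr mulmxDl -!scalemxAr -!scalemxAl !mxE.
move: (pM x x0) (pN x x0).
rewrite !mxE; set a := \sum_j _; set b := \sum_j _ => a0 b0.
have [->|t_neq0] := eqVneq t 0; first by rewrite mul0r add0r subr0 mul1r.
have t_gt0 : 0 < t by rewrite lt_def t_neq0.
by rewrite ltr_pwDl ?mulr_gt0// mulr_ge0 ?subr_ge0// ltW.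
Qed.

(** The trace is the sum of the values of the quadratic form of [M] at the
    columns of [D]: this makes (P, Q) |-> tr (P^T M Q) a nonnegative form on
    matrices. *)
Lemma posdef_trace_ge0 m k (M : 'M[R]_m) (D : 'M[R]_(m, k)) :
  posdefmx M -> 0 <= \tr (D^T *m M *m D).
Proof.
move=> pM; apply: sumr_ge0 => i _.
suff -> : (D^T *m M *m D) i i = ((col i D)^T *m M *m col i D) 0 0.
  exact: posdef_form_ge0.
rewrite tr_col -row_mul.
by rewrite !mxE; apply: eq_bigr => j _; rewrite !mxE.
Qed.

Lemma posdef_trace_gt0 m (M : 'M[R]_m.+1) : posdefmx M -> 0 < \tr M.
Proof.
move=> pM.
have diag_gt0 i : 0 < M i i.
  have := pM.2 (delta_mx i 0).
  rewrite trmx_delta -rowE -colE !mxE; apply.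
  apply/eqP => /(congr1 (fun x : 'cV_m.+1 => x i 0))/eqP.
  by rewrite !mxE !eqxx oner_eq0.
rewrite /mxtrace (bigD1 ord0)//= ltr_pwDl//.
by apply: sumr_ge0 => i _; exact: ltW.
Qed.

End PositiveDefinite.

Section TraceOfSquareRoot.
Variable R : realType.

(** Cauchy-Schwarz for the inner product (U, V) |-> tr (U^T T^-1 V), where
    (P, T) = tr P, (T, T) = tr T and (P, P) = tr (T^-1 P^2).  It is obtained
    from the nonnegativity of the squared length of (tr T) P - (tr P) T, which
    is a multiple of the component of P orthogonal to T. *)
Lemma trace_cauchy_schwarz m (T P : 'M[R]_m) :
  posdefmx T -> P^T = P -> (\tr P) ^+ 2 <= \tr T * \tr (invmx T *m (P *m P)).
Proof.
(* Division by tr T requires a positive trace, hence a nonempty index set. *)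
case: m T P => [|m] T P pT sP.
  by rewrite /mxtrace !big_ord0 expr0n mul0r.
have uT := posdef_unitmx pT.
set a := \tr T; set b := \tr P; set q := \tr _.
have a0 : 0 < a by exact: posdef_trace_gt0.
have := posdef_trace_ge0 (a *: P - b *: T) (posdef_inv pT).
have -> : \tr ((a *: P - b *: T)^T *m invmx T *m (a *: P - b *: T))
  = a * (a * q - b ^+ 2).
  have -> : (a *: P - b *: T)^T = a *: P - b *: T.
    by rewrite linearB !linearZ/= sP pT.1.
  rewrite mulmxBl -!scalemxAl mulmxV// mulmxBr !mulmxBl.
  rewrite -!scalemxAl -!scalemxAr mulmxKV// !mul1mx.
  have -> : q = \tr (P *m invmx T *m P) by rewrite -mulmxA mxtrace_mulC -mulmxA.
  rewrite !linearB/= !linearZ/= -/a -/b; ring.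
by rewrite pmulr_rge0// subr_ge0.
Qed.

(** With T the square root of the intermediate point, L |-> tr T * tr (T^-1 L)
    is a linear majorant of L |-> (tr L^(1/2))^2 that is attained at that
    point. *)
Lemma trace_sqrtmx_concave m (M N : 'M[R]_m) (t : R) :
  0 <= t <= 1 -> posdefmx M -> posdefmx N ->
  t * (\tr (sqrtmx M)) ^+ 2 + (1 - t) * (\tr (sqrtmx N)) ^+ 2
  <= (\tr (sqrtmx (t *: M + (1 - t) *: N))) ^+ 2.
Proof.
move=> t01 pM pN; have pY := posdef_conv t01 pM pN.
have [pT TT] := sqrtmxP pY; set T := sqrtmx _ in pT TT *.
have bound L : posdefmx L -> (\tr (sqrtmx L)) ^+ 2 <= \tr T * \tr (invmx T *m L).
  move=> /sqrtmxP[pS SS].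
  by rewrite -[in leRHS]SS; apply: trace_cauchy_schwarz => //; exact: pS.1.
have -> : (\tr T) ^+ 2 = t * (\tr T * \tr (invmx T *m M))
                       + (1 - t) * (\tr T * \tr (invmx T *m N)).
  have trT : \tr T = t * \tr (invmx T *m M) + (1 - t) * \tr (invmx T *m N).
    rewrite -!mxtraceZ -mxtraceD !scalemxAr -mulmxDr -TT.
    by rewrite mulKmx ?posdef_unitmx.
  rewrite expr2 {2}trT; ring.
move/andP: t01 => [t0 t1].
by rewrite lerD ?ler_wpM2l ?bound ?subr_ge0.
Qed.

End TraceOfSquareRoot.

Section Kronecker.
Variable R : realType.

Lemma tensmx1 m n : (1%:M : 'M[R]_m) *t (1%:M : 'M[R]_n) = 1%:M.
Proof.
apply/matrixP => i j.
case: (mxtens_indexP i) => i1 i2; case: (mxtens_indexP j) => j1 j2.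
rewrite tensmxE !mxE -natrM mulnb (can_eq (@mxtens_indexK _ _)).
by rewrite xpair_eqE.
Qed.

Lemma mxtrace_tens m n (M : 'M[R]_m) (N : 'M[R]_n) :
  \tr (M *t N) = \tr M * \tr N.
Proof. by rewrite /mxtrace mulr_sum; apply: eq_bigr => i _; rewrite mxE. Qed.

(** With S and T the square roots of the factors, M *t N is the Gram matrix
    (S *t T)^T (S *t T), and S *t T has inverse S^-1 *t T^-1. *)
Lemma posdef_tens m n (M : 'M[R]_m) (N : 'M[R]_n) :
  posdefmx M -> posdefmx N -> posdefmx (M *t N).
Proof.
move=> /sqrtmxP[pS SM] /sqrtmxP[pT TN].
rewrite -SM -TN -tensmx_mul -[X in X *m _]mulmx1.
rewrite -{1}pS.1 -{1}pT.1 -trmx_tens.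
apply: (@posdef_congr _ _ _ _ _ (invmx (sqrtmx M) *t invmx (sqrtmx N))).
  exact: posdef1.
by rewrite tensmx_mul !mulVmx ?posdef_unitmx// tensmx1.
Qed.

(** By the mixed product rule, the right-hand side is a positive definite matrix
    whose square is M *t N; the square root is unique. *)
Lemma sqrtmx_tens m n (M : 'M[R]_m) (N : 'M[R]_n) :
  posdefmx M -> posdefmx N -> sqrtmx (M *t N) = sqrtmx M *t sqrtmx N.
Proof.
move=> pM pN; have [pS SS] := sqrtmxP (posdef_tens pM pN).
have [pSM SM] := sqrtmxP pM; have [pSN SN] := sqrtmxP pN.
by apply: sqrtmx_unique => //; [exact: posdef_tens|rewrite SS tensmx_mul SM SN].
Qed.

End Kronecker.

Section Objective.
Variable R : realType.

Lemma posdef_sandwich d (A X : 'M[R]_d) :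
  posdefmx A -> posdefmx X -> posdefmx (sqrtmx A *m X *m sqrtmx A).
Proof.
move=> /sqrtmxP[pS _] pX; rewrite -{1}pS.1.
by apply: posdef_congr pX (mulVmx (posdef_unitmx pS)).
Qed.

(** The mixed product rule turns the inner matrix
    (S *t S) (X *t X) (S *t S) into (S X S) *t (S X S), whose square root and
    trace then factor as well. *)
Lemma barycenter_objectiveE n d (A : 'I_n -> 'M[R]_d) (X : 'M[R]_d) :
  (forall i, posdefmx (A i)) -> posdefmx X ->
  barycenter_objective A X =
  \sum_(i < n) ((\tr (A i)) ^+ 2 + (\tr X) ^+ 2
    - 2 * (\tr (sqrtmx (sqrtmx (A i) *m X *m sqrtmx (A i)))) ^+ 2).
Proof.
move=> pA pX; apply: eq_bigr => i _.
have pSXS := posdef_sandwich (pA i) pX.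
by rewrite sqrtmx_tens// !tensmx_mul sqrtmx_tens// !mxtrace_tens !expr2.
Qed.

Lemma sqr_convex (x y t : R) : 0 <= t <= 1 ->
  (t * x + (1 - t) * y) ^+ 2 <= t * x ^+ 2 + (1 - t) * y ^+ 2.
Proof.
move=> /andP[t0 t1]; rewrite -subr_ge0.
have -> : t * x ^+ 2 + (1 - t) * y ^+ 2 - (t * x + (1 - t) * y) ^+ 2
  = t * (1 - t) * (x - y) ^+ 2 by ring.
by rewrite mulr_ge0 ?sqr_ge0// mulr_ge0 ?subr_ge0.
Qed.

End Objective.

Theorem lemma4p2 (R : realType) (n d : nat) (A : 'I_n -> 'M[R]_d)
    (posA : forall i : 'I_n, posdefmx (A i)) :
  convex_set (posdef_cone R d) /\
  convex_function (posdef_cone R d) (barycenter_objective A).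
Proof.
have t01 (t : {i01 R}) : 0 <= t%:num <= 1 by apply/andP; split.
split=> [X Y t /set_mem pX /set_mem pY|t X Y /set_mem pX /set_mem pY].
  by apply/mem_set; exact: posdef_conv.
have pZ := posdef_conv (t01 t) pX pY.
(* The convex combinations of points and of values, both by conversion. *)
change (barycenter_objective A (t%:num *: X + (1 - t%:num) *: Y)
  <= t%:num * barycenter_objective A X
     + (1 - t%:num) * barycenter_objective A Y).
move: (t%:num) (t01 t) pZ => {t t01} t t01 pZ.
rewrite !barycenter_objectiveE// !mulr_sumr -big_split/=.
apply: ler_sum => i _.
have := sqr_convex (\tr X) (\tr Y) t01.
have := trace_sqrtmx_concave t01 (posdef_sandwich (posA i) pX)
  (posdef_sandwich (posA i) pY).
rewrite mulmxDr mulmxDl -!scalemxAr -!scalemxAl linearD !linearZ/=.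
lra.
Qed.
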